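(* Let $m=rn$. There is a bijection between $\overline G_r(U,V;d)$ and the set of walks in $\widetilde W(d,2m;\vec 0)$ all of whose points lie in the region $\{x\in\mathbb Z^d: x_1\ge x_2\ge\cdots\ge x_d\}$.
   Context: Fix integers $n,r,d\ge1$, $m=rn$. $U=\{u_1\prec\cdots\prec u_n\}$, $V=\{v_1\prec\cdots\prec v_n\}$ are disjoint totally ordered sets. An $r$-regular bipartite multigraph on $(U,V)$ is a multiset of edges $uv$ in which every vertex has degree $r$. Edges $uv,u'v'$ are noncrossing if ($u\prec u'$ and $v\prec v'$) or ($u'\prec u$ and $v'\prec v$); a planar matching is a set of pairwise noncrossing edges; $L(G)$ is the maximum size of a planar matching; $G_r(U,V;d)$ is the set of $r$-regular multigraphs $G$ with $L(G)\le d$. Let $\overline U=U\times[r]$, $\overline V=V\times[r]$ (write $u^s$ for $(u,s)$), ordered lexicographically. An $r$-configuration is a bijection between $\overline U$ and $\overline V$. For $G$ an $r$-regular multigraph, its associated configuration $\overline G$: for each edge $uv$ of $G$ of multiplicity $t\ge1$, let $i$ be the number of edges $uv'$ of $G$ (with multiplicity) with $v\prec v'$, $j$ the number of edges $u'v$ with $u\prec u'$; $\overline G$ contains the pairs $(u^{i+s},v^{j+t-s+1})$, $s=1,\dots,t$. $\overline G_r(U,V;d)=\{\overline G:G\in G_r(U,V;d)\}$. Walks: $W^*(d,2m;P)$ is the set of walks in $\mathbb Z^d$ from the origin with steps $e_{a_1},\dots,e_{a_m},-e_{b_1},\dots,-e_{b_m}$ ($a_i,b_i\in[d]$) ending in $P$,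 written $a_1\cdots a_m|b_1\cdots b_m$; write $a_{u_i^s}=a_{r(i-1)+s}$, $b_{v_i^s}=b_{r(i-1)+s}$. $W'(d,2m;P)$ is the set of such walks with $a_{u^s}\ge a_{u^{s+1}}$ and $b_{v^s}\ge b_{v^{s+1}}$ for all $u\in U,v\in V$, $1\le s<r$. For $w=a_1\cdots a_m|b_1\cdots b_m\in W'(d,2m;\vec 0)$ let $\tilde w=a_1\cdots a_m|b_m b_{m-1}\cdots b_1$ (the negative steps taken in reverse order), and $\widetilde W(d,2m;\vec 0)=\{\tilde w: w\in W'(d,2m;\vec 0)\}$. A walk stays in a region if all its visited lattice points (including start and end) lie in it. *)

(* Defs.v *)
From mathcomp Require Import all_boot all_order all_algebra.
Set Implicit Arguments. Unset Strict Implicit. Unset Printing Implicit Defensive.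
Import Order.TTheory GRing.Theory Num.Theory.

(* U = V = 'I_n ordered by index (u_{i+1} is the ordinal i).
   A multigraph on (U,V) is given by its edge-multiplicity function. *)
Definition mgraph (n : nat) := 'I_n -> 'I_n -> nat.

Definition regular (n r : nat) (G : mgraph n) : Prop :=
  (forall u : 'I_n, \sum_(v < n) G u v = r) /\
  (forall v : 'I_n, \sum_(u < n) G u v = r).

Definition noncrossing (n : nat) (e e' : 'I_n * 'I_n) : bool :=
  ((e.1 < e'.1) && (e.2 < e'.2)) || ((e'.1 < e.1) && (e'.2 < e.2)).

Definition planar_matching (n : nat) (G : mgraph n) (P : {set 'I_n * 'I_n}) : bool :=
  [forall e in P, 0 < G e.1 e.2] &&
  [forall e in P, forall e' in P, (e != e') ==> noncrossing e e'].

Definition Lmax (n : nat) (G : mgraph n) : nat :=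
  \max_(P : {set 'I_n * 'I_n} | planar_matching G P) #|P|.

(* barU = barV = 'I_n * 'I_r : (u_{i+1})^{s+1} is (i, s) (0-based superscripts);
   an r-configuration is represented by its graph, a set of pairs (x, y)
   with x in barU, y in barV. *)
Definition config (n r : nat) := {set ('I_n * 'I_r) * ('I_n * 'I_r)}.

Definition iU (n : nat) (G : mgraph n) (u v : 'I_n) : nat :=
  \sum_(v' < n | v < v') G u v'.
Definition jV (n : nat) (G : mgraph n) (u v : 'I_n) : nat :=
  \sum_(u' < n | u < u') G u' v.

(* associated configuration: for each edge uv of multiplicity t >= 1, the pairs
   (u^{i+s}, v^{j+t-s+1}), s = 1..t (1-based superscripts, shifted to 0-based). *)
Definition assoc_config (n r : nat) (G : mgraph n) : config n r :=
  [set p : ('I_n * 'I_r) * ('I_n * 'I_r) |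
    [exists u : 'I_n, exists v : 'I_n,
      (0 < G u v) &&
      has (fun s => [&& p.1.1 == u, val p.1.2 == iU G u v + s - 1,
                        p.2.1 == v & val p.2.2 == jV G u v + G u v - s])
          (iota 1 (G u v))]].

Definition Gbar (n r d : nat) (C : config n r) : Prop :=
  exists G : mgraph n, regular r G /\ Lmax G <= d /\ C = assoc_config r G.

(* Walks a_1..a_m | b_1..b_m with directions in [d] represented by 'I_d (0-based). *)
Definition walk (d m : nat) := (m.-tuple 'I_d * m.-tuple 'I_d)%type.

(* steps e_{a_1},...,e_{a_m}, -e_{b_1},...,-e_{b_m} (true = positive step) *)
Definition wsteps (d : nat) (a b : seq 'I_d) : seq (bool * 'I_d) :=
  [seq (true, x) | x <- a] ++ [seq (false, x) | x <- b].

Definition wpos (d : nat) (a b : seq 'I_d) (k : nat) (c : 'I_d) : int :=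
  (count (pred1 (true, c)) (take k (wsteps a b)))%:Z
  - (count (pred1 (false, c)) (take k (wsteps a b)))%:Z.

Definition ends_at_origin (d m : nat) (w : walk d m) : bool :=
  [forall c : 'I_d, wpos w.1 w.2 (m + m) c == 0].

Definition in_chamber (d m : nat) (w : walk d m) : bool :=
  [forall k : 'I_(m + m).+1, forall c1 : 'I_d, forall c2 : 'I_d,
     (c1 <= c2) ==> (wpos w.1 w.2 k c2 <= wpos w.1 w.2 k c1)%R].

(* W'(d, 2m; 0) with m = r n: a_{u^s} >= a_{u^{s+1}}, b_{v^s} >= b_{v^{s+1}},
   where a_{u_i^s} = a_{r(i-1)+s}. *)
Definition Wprime (n r d : nat) : {set walk d (r * n)} :=
  [set w : walk d (r * n) | ends_at_origin w &&
     [forall i : 'I_n, forall s : 'I_r, (s.+1 < r) ==>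
        ((nth 0 (map val w.1) (r * i + s.+1) <= nth 0 (map val w.1) (r * i + s)) &&
         (nth 0 (map val w.2) (r * i + s.+1) <= nth 0 (map val w.2) (r * i + s)))]].

Definition Wtilde (n r d : nat) : {set walk d (r * n)} :=
  [set ((w.1, rev_tuple w.2) : walk d (r * n)) | w in Wprime n r d].

Definition Wtilde_chamber (n r d : nat) : {set walk d (r * n)} :=
  [set w in Wtilde n r d | in_chamber w].
Arguments Gbar n r d C : clear implicits.

(* Main.v *)
Require Import Defs.
From mathcomp Require Import all_boot all_order all_algebra zify boolp.
Set Implicit Arguments. Unset Strict Implicit. Unset Printing Implicit Defensive.

(** Cutting a walk of the chamber at its midpoint leaves two chains of partitions
    with at most [d] parts, from the empty partition to a common one, whose
    consecutive terms differ by horizontal strips of size [r].  Such pairs of chains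
    form the boundary of a growth diagram on the [n] by [n] grid (Burge's variant of
    RSK, in Fomin's form): a local rule determines, in each cell, the fourth corner
    from the other three and the entry of the cell, and conversely the inner corner
    and the entry from the remaining corners.  The entries are the edge
    multiplicities.  Locally, the number of parts of the outer corner is the maximum
    of the numbers of parts of its two neighbours and, if the entry is positive, of
    one plus that of the inner corner; this is also the recursion for the largest
    planar matching, so no Greene-type theorem is needed. *)

(** * Partitions and the local rule *)

Definition horizontal_strip (x y : nat -> nat) :=
  forall k, x k <= y k /\ y k.+1 <= x k.

Definition bounded d (x : nat -> nat) := forall k, d <= k -> x k = 0.

(* The entry [a] enters at the last part and is carried up ([c]): part [k.+1] of [w]
   grows until it meets part [k] of [x], and the excess [c k.+1] moves on to part [k]. *)
Definition local_rule d (x y z : nat -> nat) (a : nat) (w : nat -> nat) :=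
  exists c : nat -> nat, [/\ c 0 = 0, c d = a &
    forall k, k < d ->
      [/\ c k.+1 + y k + z k = w k + c k + x k, w k.+1 <= x k &
          c k.+1 = 0 \/ w k.+1 = x k]].

Section LocalRule.
Variable d : nat.
Implicit Types x y z w c : nat -> nat.

(* [rev_carry x y z a j] is the carry [c (d - j)] of the local rule. *)
Fixpoint rev_carry x y z a j :=
  if j is j'.+1 then
    if d - j is k.+1 then y k.+1 + z k.+1 - x k.+1 + rev_carry x y z a j' - x k
    else 0
  else a.

(** The balance equation prescribes [w k + c k] once [c k.+1] is known. Part [k] takes as much of
    this sum as the cap [x k.-1] allows, hence the minimum; part 0 has no cap and absorbs all that
    reaches it. *)
Definition fwd x y z a k :=
  let s := y k + z k - x k + rev_carry x y z a (d - k.+1) in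
  if k < d then if k is k'.+1 then minn (x k') s else s else 0.

(** The condition on [a] is forced by the rule: since [w d = 0], its last instance admits a positive
    entry only if [x d.-1 = 0], that is, if there is room for one more part. *)
Lemma fwdP x y z a :
  0 < d -> bounded d x -> horizontal_strip x y -> horizontal_strip x z ->
  bounded d y -> bounded d z -> (0 < a -> x d.-1 = 0) ->
  [/\ bounded d (fwd x y z a), horizontal_strip y (fwd x y z a),
      horizontal_strip z (fwd x y z a) &
      local_rule d x y z a (fwd x y z a)].
Proof.
move=> d0 bx xy xz by_ bz ax.
have le_fwd k : fwd x y z a k.+1 <= x k by rewrite /fwd; case: ifP; lia.
have ge_fwd k : y k <= fwd x y z a k /\ z k <= fwd x y z a k.
  rewrite /fwd; case: ltnP => kd; last by rewrite by_ ?bz.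
  by case: k kd => [|k] kd; [move: (xy 0) (xz 0)|move: (xy k) (xz k) (xy k.+1) (xz k.+1)]; lia.
split.
- by move=> k; rewrite /fwd; case: ltnP.
- by move=> k; move: (ge_fwd k) (le_fwd k) (xy k); lia.
- by move=> k; move: (ge_fwd k) (le_fwd k) (xz k); lia.
exists (fun k => if k is 0 then 0 else rev_carry x y z a (d - k)).
split=> //; first by case: d d0 => // d' _; rewrite subnn.
move=> k kd; split=> //.
- move: (xy k) (xz k); rewrite /fwd kd.
  case: k kd => [|k] kd; first by lia.
  have -> : d - k.+1 = (d - k.+2).+1 by lia.
  rewrite /=.
  have -> : d - (d - k.+2).+1 = k.+1 by lia.
  move: (xy k) (xz k); lia.
- case: (ltnP k.+1 d) => kd1; last first.
    have -> : d - k.+1 = 0 by lia.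
    rewrite /fwd ltnNge kd1 /=; case: (posnP a) => [->|/ax x0]; first by left.
    by right; rewrite -x0; congr (x _); lia.
  rewrite /fwd kd1; have -> : d - k.+1 = (d - k.+2).+1 by lia.
  rewrite /=.
  have -> : d - (d - k.+2).+1 = k.+1 by lia.
  by rewrite -/(fwd x y z a); lia.
Qed.

(** Backwards, the carry is computed from [c 0 = 0] with increasing index. The rule says that
    [x k - w k.+1] and [c k.+1] are nonnegative and one of them vanishes, so [x k] is the maximum
    used in [bwd], and the balance equation then yields [c k.+1]. The entry is the carry that comes
    out at index [d]. *)
Fixpoint bwd_carry y z w k :=
  if k is j.+1 then
    w j + bwd_carry y z w j + maxn (w k) (y j + z j - w j - bwd_carry y z w j)
    - y j - z j
  else 0.

Definition bwd y z w k := maxn (w k.+1) (y k + z k - w k - bwd_carry y z w k).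

Lemma bwdP y z w :
  horizontal_strip y w -> horizontal_strip z w -> bounded d w ->
  [/\ bounded d (bwd y z w), horizontal_strip (bwd y z w) y,
      horizontal_strip (bwd y z w) z &
      local_rule d (bwd y z w) y z (bwd_carry y z w d) w].
Proof.
move=> yw zw bw; split.
- by move=> k dk; rewrite /bwd; move: (bw k dk) (yw k) (zw k); lia.
- by move=> k; rewrite /bwd; move: (yw k) (zw k) (yw k.+1) (zw k.+1); lia.
- by move=> k; rewrite /bwd; move: (yw k) (zw k) (yw k.+1) (zw k.+1); lia.
exists (bwd_carry y z w); split=> // k kd.
by rewrite /bwd /=; move: (yw k) (zw k); split; lia.
Qed.

(** Descending induction from index [d], where [c] and [w] are both known. If [c k.+1] is known, so
    is [w k + c k], and the alternative in the rule leaves only one way to split it; at [k = 0] the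
    split is given by [c 0 = 0]. *)
Lemma local_rule_fwd_uniq x y z a w w' :
  bounded d w -> bounded d w' -> local_rule d x y z a w -> local_rule d x y z a w' -> w =1 w'.
Proof.
move=> bw bw' [c [c0 cd H]] [c' [c0' cd' H']].
have E j : j <= d -> c (d - j) = c' (d - j) /\ w (d - j) = w' (d - j).
  elim: j => [|j IH] jd; first by rewrite subn0 bw // bw' // cd cd'.
  have [|Ec _] := IH; first lia.
  have kd : d - j.+1 < d by lia.
  have [e _ _] := H _ kd; have [e' _ _] := H' _ kd.
  move: e e'; have -> : (d - j.+1).+1 = d - j by lia.
  case Ek: (d - j.+1) => [|k] e e'; first by lia.
  have kd' : k < d by lia.
  by have [_ ? ?] := H _ kd'; have [_ ? ?] := H' _ kd'; lia.
move=> k; case: (leqP d k) => kd; first by rewrite bw ?bw'.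
have [|_] := E (d - k); first lia.
by have -> : d - (d - k) = k by lia.
Qed.

(** Ascending induction from [c 0 = 0]: the balance fixes the difference of [c k.+1] and [x k], and
    the alternative in the rule then fixes both. *)
Lemma local_rule_bwd_uniq x x' y z a a' w :
  bounded d x -> bounded d x' -> local_rule d x y z a w -> local_rule d x' y z a' w ->
  x =1 x' /\ a = a'.
Proof.
move=> bx bx' [c [c0 cd H]] [c' [c0' cd' H']].
have E k : k <= d -> c k = c' k.
  elim: k => [|k IH] kd; first by lia.
  by have [? ? ?] := H _ kd; have [? ? ?] := H' _ kd; have := IH (ltnW kd); lia.
split; last by rewrite -cd -cd' E.
move=> k; case: (leqP d k) => kd; first by rewrite bx ?bx'.
by have [? _ _] := H _ kd; have [? _ _] := H' _ kd; move: (E k) (E k.+1); lia.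
Qed.

(** In the sum of the balance equations the carries telescope to [c d - c 0], which is [a]. *)
Lemma local_rule_sum x y z a w :
  local_rule d x y z a w ->
  a + \sum_(k < d) y k + \sum_(k < d) z k = \sum_(k < d) w k + \sum_(k < d) x k.
Proof.
case=> c [c0 <- H].
have E k : k <= d -> c k + \sum_(i < k) y i + \sum_(i < k) z i
                     = \sum_(i < k) w i + \sum_(i < k) x i.
  elim: k => [|k IH] kd; first by rewrite !big_ord0 c0.
  rewrite !big_ord_recr /=; have [? _ _] := H k kd; have := IH (ltnW kd).
  move: (\sum_(i < k) y i) (\sum_(i < k) z i) (\sum_(i < k) w i) (\sum_(i < k) x i).
  by lia.
exact: E.
Qed.

Definition nb_parts (x : nat -> nat) l := forall k, (0 < x k) = (k < l).

(** Beyond index [lx] interlacing makes all four partitions too short to hold anything, so the entry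
    travels unchanged up to part [lx]. If it is positive, that part of [w] becomes positive; the
    parts before it already contain those of [x]. *)
Lemma local_rule_nb_parts x y z a w lx ly lz :
  horizontal_strip x y -> horizontal_strip x z ->
  bounded d x -> bounded d y -> bounded d z -> bounded d w ->
  horizontal_strip y w -> 0 < d -> local_rule d x y z a w ->
  nb_parts x lx -> nb_parts y ly -> nb_parts z lz ->
  nb_parts w (maxn (maxn ly lz) (if 0 < a then lx.+1 else 0)).
Proof.
move=> xy xz bx by_ bz bw yw d0 [c [c0 cd H]] nx ny nz k.
have ca j : lx < d - j -> j < d -> c (d - j) = a.
  elim: j => [|j IH] lj jd; first by rewrite subn0.
  have kd : d - j.+1 < d by lia.
  have [e _ _] := H _ kd; move: e; have -> : (d - j.+1).+1 = d - j by lia.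
  rewrite IH; [|lia|lia].
  case Ek: (d - j.+1) => [|k']; first by lia.
  have kd' : k' < d by lia.
  have [_ ? _] := H _ kd'.
  move: (nx k') (nx k'.+1) (xy k') (xz k'); lia.
case: (ltngtP k lx) => klx.
- move: (xy k) (yw k) (nx k) (ny k); lia.
- case: k klx => // k klx.
  move: (xy k) (xz k) (nx k) (ny k.+1) (nz k.+1).
  case: (ltnP k d) => kd; first by have [_ ? _] := H k kd; case: ifP; lia.
  by have := bw k.+1 (leqW kd); case: ifP; lia.
rewrite -klx in ca nx *; case: (ltnP k d) => kd.
  have := ca (d - k.+1).
  have -> : d - (d - k.+1) = k.+1 by lia.
  move=> /(_ (ltnSn _)) cka.
  have {}cka : c k.+1 = a by apply: cka; lia.
  move: (nx k) (ny k) (nz k); have [e _ _] := H _ kd.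
  case: k kd cka e {ca klx} nx => [|k] kd cka e nx; first by case: ifP; lia.
  have [_ ? ?] := H k (ltnW kd); have := nx k.
  by case: ifP; lia.
(* Here [x] already has at least [d] parts, so [x d.-1 > 0 = w d] and the last instance of the rule
   excludes a positive entry. *)
move: (bw k kd) (ny k) (nz k) (by_ k kd) (bz k kd).
case: ifP => a0; last by lia.
have d1 : d.-1 < d by lia.
have [_ _] := H _ d1; rewrite prednK // cd bw //; have := nx d.-1; lia.
Qed.
End LocalRule.

(** * Growth diagrams on a square grid *)

Section Grid.
Variables (T : Type) (f : nat -> nat -> T -> T -> T -> T) (row col : nat -> T).

(** The inner fixpoint runs along one line, which makes the double recursion structural. *)
Fixpoint grid i :=
  if i is i'.+1 then
    (fix line j := if j is j'.+1 then f i' j' (grid i' j') (line j') (grid i' j) else col i)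
  else row.

(** An invariant [P] of the nodes and relations [H], [V] along the two kinds of edges are propagated
    together. It serves the forward construction and, with reversed indices and reversed relations,
    the backward one. *)
Lemma gridP n (P : nat -> nat -> T -> Prop) (H V : T -> T -> Prop) :
  row 0 = col 0 ->
  (forall j, j <= n -> P 0 j (row j)) -> (forall i, i <= n -> P i 0 (col i)) ->
  (forall j, j < n -> H (row j) (row j.+1)) -> (forall i, i < n -> V (col i) (col i.+1)) ->
  (forall i j x y z, i < n -> j < n -> P i j x -> P i.+1 j y -> P i j.+1 z ->
     V x y -> H x z ->
     [/\ P i.+1 j.+1 (f i j x y z), H y (f i j x y z) & V z (f i j x y z)]) ->
  [/\ forall i j, i <= n -> j <= n -> P i j (grid i j),
      forall i j, i <= n -> j < n -> H (grid i j) (grid i j.+1) &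
      forall i j, i < n -> j <= n -> V (grid i j) (grid i.+1 j)].
Proof.
move=> rc Prow Pcol Hrow Vcol step.
have base i : grid i 0 = col i by case: i.
have next i : i < n ->
    (forall j, j <= n -> P i j (grid i j)) /\
    (forall j, j < n -> H (grid i j) (grid i j.+1)) ->
  [/\ forall j, j <= n -> P i.+1 j (grid i.+1 j),
      forall j, j < n -> H (grid i.+1 j) (grid i.+1 j.+1) &
      forall j, j <= n -> V (grid i j) (grid i.+1 j)].
  move=> lt_in [Pi Hi].
  have PV j : j <= n -> P i.+1 j (grid i.+1 j) /\ V (grid i j) (grid i.+1 j).
    elim: j => [|j IH] jn; first by rewrite !base; auto.
    have [p v] := IH (ltnW jn).
    by have [] := step i j _ _ _ lt_in jn (Pi _ (ltnW jn)) p (Pi _ jn) v (Hi _ jn).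
  split=> j jn; try by case: (PV j jn).
  have [p v] := PV j (ltnW jn).
  by have [] := step i j _ _ _ lt_in jn (Pi _ (ltnW jn)) p (Pi _ jn) v (Hi _ jn).
have PH i : i <= n -> (forall j, j <= n -> P i j (grid i j)) /\
    (forall j, j < n -> H (grid i j) (grid i j.+1)).
  by elim: i => [|i IH] lt_in //; have [] := next i lt_in (IH (ltnW lt_in)).
split=> i j lt_in.
- by have [+ _] := PH i lt_in; apply.
- by have [_ +] := PH i lt_in; apply.
- by have [_ _] := next i lt_in (PH i (ltnW lt_in)); apply.
Qed.
End Grid.

(** The length of a longest sequence of positive cells, strictly increasing in both coordinates,
    within the first [i] rows and [j] columns. Its recursion has the shape of
    [local_rule_nb_parts]. *)
Definition chain_len (g : nat -> nat -> nat) :=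
  grid (fun i j x y z => maxn (maxn y z) (if 0 < g i j then x.+1 else 0))
       (fun=> 0) (fun=> 0).

Lemma chain_lenS g i j : chain_len g i.+1 j.+1 =
  maxn (maxn (chain_len g i.+1 j) (chain_len g i j.+1))
       (if 0 < g i j then (chain_len g i j).+1 else 0).
Proof. by []. Qed.

Lemma chain_len0l g j : chain_len g 0 j = 0. Proof. by []. Qed.

Lemma chain_len0r g i : chain_len g i 0 = 0. Proof. by case: i. Qed.

Lemma leq_chain_len g i j i' j' :
  i <= i' -> j <= j' -> chain_len g i j <= chain_len g i' j'.
Proof.
move=> ii' jj'; apply: (@leq_trans (chain_len g i j')).
  elim: j' jj' => [|j' IH]; first by rewrite leqn0 => /eqP ->.
  rewrite leq_eqVlt ltnS => /orP [/eqP -> //|/IH /leq_trans]; apply.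
  by case: i {ii' IH} => // i; rewrite chain_lenS; lia.
elim: i' ii' => [|i' IH]; first by rewrite leqn0 => /eqP ->.
rewrite leq_eqVlt ltnS => /orP [/eqP -> //|/IH /leq_trans]; apply.
by case: j' {jj' IH} => [|j']; rewrite ?chain_len0r // chain_lenS; lia.
Qed.

(** The nodes need no separate monotonicity clause: two interlacing sequences are both weakly
    decreasing, hence partitions. *)
Definition growth d n (g : nat -> nat -> nat) (X : nat -> nat -> nat -> nat) :=
  [/\ forall i j, i <= n -> j <= n ->
        bounded d (X i j) /\ (i = 0 \/ j = 0 -> forall k, X i j k = 0),
      forall i j, i <= n -> j < n -> horizontal_strip (X i j) (X i j.+1),
      forall i j, i < n -> j <= n -> horizontal_strip (X i j) (X i.+1 j) &
      forall i j, i < n -> j < n ->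
        local_rule d (X i j) (X i.+1 j) (X i j.+1) (g i j) (X i.+1 j.+1)].

Section Growth.
Variables (d n : nat).
Implicit Types (g : nat -> nat -> nat) (X : nat -> nat -> nat -> nat).

(** The number of parts is carried along as an invariant. At a positive entry the inner corner has
    fewer parts than [chain_len g i.+1 j.+1], which is at most [d]; this is the room that [fwdP]
    asks for. *)
Lemma growth_exists g : 0 < d -> chain_len g n n <= d -> exists X, growth d n g X.
Proof.
move=> d_gt0 le_d.
have step i j x y z : i < n -> j < n ->
    bounded d x /\ nb_parts x (chain_len g i j) ->
    bounded d y -> bounded d z ->
    horizontal_strip x y -> horizontal_strip x z ->
    let w := fwd d x y z (g i j) in
    [/\ bounded d w, horizontal_strip y w, horizontal_strip z w &
        local_rule d x y z (g i j) w].
  move=> lt_in lt_jn [bx nx] by_ bz xy xz; apply: fwdP => // gij.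
  have := nx d.-1; have := @leq_chain_len g _ _ _ _ lt_in lt_jn.
  by rewrite chain_lenS gij; lia.
pose X := grid (fun i j x y z => fwd d x y z (g i j)) (fun _ _ => 0) (fun _ _ => 0).
have [] := @gridP _ (fun i j x y z => fwd d x y z (g i j)) (fun _ _ => 0) (fun _ _ => 0)
  n (fun i j x => bounded d x /\ nb_parts x (chain_len g i j)) horizontal_strip horizontal_strip => //.
- by move=> i _; rewrite chain_len0r.
- move=> i j x y z lt_in lt_jn [bx nx] [by_ ny] [bz nz] xy xz.
  have [bw yw zw rw] := step i j x y z lt_in lt_jn (conj bx nx) by_ bz xy xz.
  by split=> //; split=> //; apply: local_rule_nb_parts rw nx ny nz.
rewrite -/X => PX HX VX; exists X; split=> //.
- move=> i j lt_in lt_jn; have [bX nX] := PX i j lt_in lt_jn; split=> // ij0 k.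
  by have := nX k; case: ij0 => ->; rewrite ?chain_len0l ?chain_len0r; lia.
- move=> i j lt_in lt_jn.
  have [//|||||_ _ _] := step i j (X i j) (X i.+1 j) (X i j.+1) lt_in lt_jn.
  + by apply: PX; apply: ltnW.
  + by have [] := PX i.+1 j lt_in (ltnW lt_jn).
  + by have [] := PX i j.+1 (ltnW lt_in) lt_jn.
  + exact: VX (ltnW _).
  + exact: HX (ltnW _) _.
  by [].
Qed.

Lemma growth_chain_len g X : 0 < d -> growth d n g X -> chain_len g n n <= d.
Proof.
move=> d_gt0 [PX HX VX RX].
have N i : i <= n -> forall j, j <= n -> nb_parts (X i j) (chain_len g i j).
  elim: i => [|i IHi] lt_in; first by move=> j jn k; have [_ ->] := PX 0 j lt_in jn; auto.
  elim=> [|j IHj] lt_jn; first by move=> k; have [_ ->] := PX i.+1 0 lt_in lt_jn; auto.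
  have [lt_in' lt_jn'] := (ltnW lt_in, ltnW lt_jn).
  apply: local_rule_nb_parts (RX i j lt_in lt_jn) (IHi lt_in' j lt_jn') (IHj lt_jn')
           (IHi lt_in' j.+1 lt_jn) => //;
    by [auto | have [] := PX i j; auto | have [] := PX i.+1 j; auto
       | have [] := PX i j.+1; auto | have [] := PX i.+1 j.+1; auto].
have := N n (leqnn n) n (leqnn n) d; have [-> //] := PX n n (leqnn n) (leqnn n).
by lia.
Qed.

(** [local_rule_sum] is the inclusion-exclusion step for sums over rectangles. Through this lemma
    vertex degrees become increments of size along the outer boundary. *)
Lemma growth_sum g X i j : growth d n g X -> i <= n -> j <= n ->
  \sum_(k < d) X i j k = \sum_(i' < i) \sum_(j' < j) g i' j'.
Proof.
case=> PX _ _ RX.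
elim: i j => [|i IHi] j lt_in lt_jn.
  by rewrite big_ord0 big1 // => k _; have [_ ->] := PX 0 j lt_in lt_jn; auto.
elim: j lt_jn => [|j IHj] lt_jn.
  rewrite big1 => [|k _]; last by have [_ ->] := PX i.+1 0 lt_in lt_jn; auto.
  by rewrite big1 // => i' _; rewrite big_ord0.
have := local_rule_sum (RX i j lt_in lt_jn).
rewrite (IHj (ltnW lt_jn)) !IHi; try exact: ltnW; rewrite //.
have RS a : \sum_(i' < a) \sum_(j' < j.+1) g i' j' =
    \sum_(i' < a) \sum_(j' < j) g i' j' + \sum_(i' < a) g i' j.
  by rewrite -big_split /=; apply: eq_bigr => a' _; rewrite big_ord_recr.
rewrite !RS [\sum_(i' < i.+1) g i' j]big_ord_recr /=.
move: (\sum_(i' < i) \sum_(j' < j) g i' j') (\sum_(i' < i.+1) \sum_(j' < j) g i' j')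
  (\sum_(i' < i) g i' j) (\sum_(k < d) X i.+1 j.+1 k).
by lia.
Qed.

Lemma growth_uniq_fwd g X X' : growth d n g X -> growth d n g X' ->
  forall i j, i <= n -> j <= n -> X i j = X' i j.
Proof.
case=> PX _ _ RX [PX' _ _ RX'].
elim=> [|i IHi] j lt_in lt_jn.
  by apply/funext => k; have [_ E] := PX 0 j lt_in lt_jn; have [_ E'] := PX' 0 j lt_in lt_jn; rewrite E ?E'; auto.
elim: j lt_jn => [|j IHj] lt_jn.
  by apply/funext => k; have [_ E] := PX i.+1 0 lt_in lt_jn; have [_ E'] := PX' i.+1 0 lt_in lt_jn; rewrite E ?E'; auto.
have [lt_in' lt_jn'] := (ltnW lt_in, ltnW lt_jn).
apply/funext; apply: local_rule_fwd_uniq (RX i j lt_in lt_jn) _.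
- by case: (PX i.+1 j.+1 lt_in lt_jn).
- by case: (PX' i.+1 j.+1 lt_in lt_jn).
by rewrite IHj // !IHi //; apply: RX'.
Qed.

Lemma growth_uniq_bwd g g' X X' : growth d n g X -> growth d n g' X' ->
  (forall i, i <= n -> X i n = X' i n) -> (forall j, j <= n -> X n j = X' n j) ->
  forall i j, i < n -> j < n -> g i j = g' i j.
Proof.
case=> PX _ _ RX [PX' _ _ RX'] Xc Xr.
have E i j : i < n -> j < n -> X i.+1 j = X' i.+1 j -> X i j.+1 = X' i j.+1 ->
    X i.+1 j.+1 = X' i.+1 j.+1 -> X i j = X' i j /\ g i j = g' i j.
  move=> lt_in lt_jn e1 e2 e3.
  have R := RX' i j lt_in lt_jn; rewrite -e1 -e2 -e3 in R.
  have [||/funext ? ?] := local_rule_bwd_uniq _ _ (RX i j lt_in lt_jn) R => //.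
    by case: (PX i j (ltnW _) (ltnW _)).
  by case: (PX' i j (ltnW _) (ltnW _)).
(* Indices are counted from the outer corner, so that ordinary induction moves inward. *)
have XE a b : a <= n -> b <= n -> X (n - a) (n - b) = X' (n - a) (n - b).
  elim: a b => [|a IHa] b an bn; first by rewrite subn0 Xr ?leq_subr.
  elim: b bn => [|b IHb] bn; first by rewrite subn0 Xc ?leq_subr.
  have Sa : (n - a.+1).+1 = n - a by lia.
  have Sb : (n - b.+1).+1 = n - b by lia.
  have [||||| -> _] := E (n - a.+1) (n - b.+1); rewrite ?Sa ?Sb //; try lia.
  - by apply: IHa; lia.
  - by apply: IHb; lia.
  - by apply: IHa; lia.
have XE' i j : i <= n -> j <= n -> X i j = X' i j.
  by move=> le_in le_jn; rewrite -(subKn le_in) -(subKn le_jn) XE ?leq_subr.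
by move=> i j lt_in lt_jn; have [||||| _ ->] := E i j => //; apply: XE' => //; apply: ltnW.
Qed.

(** The grid is filled by [bwd] from the outer corner, with both indices reversed;
    [alpha n = beta n] makes the two given sides meet there. *)
Lemma growth_exists_bwd (alpha beta : nat -> nat -> nat) :
  (forall k, alpha 0 k = 0) -> (forall k, beta 0 k = 0) -> alpha n = beta n ->
  (forall i, i <= n -> bounded d (alpha i)) -> (forall j, j <= n -> bounded d (beta j)) ->
  (forall i, i < n -> horizontal_strip (alpha i) (alpha i.+1)) ->
  (forall j, j < n -> horizontal_strip (beta j) (beta j.+1)) ->
  exists g X, [/\ growth d n g X, forall i, i <= n -> X i n = alpha i &
                  forall j, j <= n -> X n j = beta j].
Proof.
move=> a0 b0 ab ba bb sa sb.
(* Reversing the indices exchanges the roles of the two neighbours, whence the order of [z] and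
   [y]. *)
pose f (i j : nat) w (z y : nat -> nat) := bwd y z w.
pose row j := beta (n - j); pose col i := alpha (n - i).
have [] := @gridP _ f row col n
  (fun i j x => bounded d x /\ (i = n \/ j = n -> forall k, x k = 0))
  (fun x y => horizontal_strip y x) (fun x y => horizontal_strip y x).
- by rewrite /row /col subn0.
- move=> j jn; split; first exact/bb/leq_subr.
  move=> e k.
  have -> : row j = beta 0.
    rewrite /row; case: e => [n0|->]; last by rewrite subnn.
    by rewrite -n0.
  by rewrite b0.
- move=> i lt_in; split; first exact/ba/leq_subr.
  move=> e k.
  have -> : col i = alpha 0.
    rewrite /col; case: e => [->|n0]; first by rewrite subnn.
    by rewrite -n0.
  by rewrite a0.
- move=> j jn; rewrite /row (_ : n - j = (n - j.+1).+1); last by lia.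
  by apply: sb; rewrite -subSn // subSS leq_subr.
- move=> i lt_in; rewrite /col (_ : n - i = (n - i.+1).+1); last by lia.
  by apply: sa; rewrite -subSn // subSS leq_subr.
- move=> i j w z y lt_in lt_jn [bw _] [bz z0] [by_ y0] zw yw.
  have [bx xy xz _] := bwdP yw zw bw; split=> //; split=> // e k.
  (* The inner sides vanish because each of their nodes is contained in the preceding one, starting
     from [alpha 0] or [beta 0]. *)
  case: e => e; apply/eqP; rewrite -leqn0.
  + by rewrite -(z0 (or_introl e) k); have [] := xz k.
  + by rewrite -(y0 (or_intror e) k); have [] := xy k.
set Y := grid f row col => PY HY VY.
pose X i j := Y (n - i) (n - j).
pose g i j := bwd_carry (X i.+1 j) (X i j.+1) (X i.+1 j.+1) d.
have base i : Y i 0 = col i by case: i => //; rewrite /Y /row /col /= subn0.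
exists g, X; split; last 2 first.
- by move=> i le_in; rewrite /X subnn base /col subKn.
- by move=> j le_jn; rewrite /X subnn /= /row subKn.
have S i : i < n -> n - i = (n - i.+1).+1 by lia.
have HX i j : i <= n -> j < n -> horizontal_strip (X i j) (X i j.+1).
  by move=> le_in lt_jn; rewrite /X (S j) //; apply: HY; lia.
have VX i j : i < n -> j <= n -> horizontal_strip (X i j) (X i.+1 j).
  by move=> lt_in le_jn; rewrite /X (S i) //; apply: VY; lia.
have PX i j : i <= n -> j <= n -> bounded d (X i j) /\ (i = 0 \/ j = 0 -> forall k, X i j k = 0).
  move=> le_in le_jn; have [||bX X0] := PY (n - i) (n - j); try exact: leq_subr.
  by split=> // -[] e; apply: X0; rewrite e subn0; auto.
split=> // i j lt_in lt_jn.
have -> : X i j = bwd (X i.+1 j) (X i j.+1) (X i.+1 j.+1).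
  by rewrite /X (S i) // (S j).
have [] // := @bwdP d (X i.+1 j) (X i j.+1) (X i.+1 j.+1).
- exact: HX.
- exact: VX.
- by case: (PX i.+1 j.+1).
Qed.
End Growth.

(** * Largest planar matchings *)

Section Matching.
Variables (n : nat) (G : mgraph n) (g : nat -> nat -> nat).
Hypothesis Gg : forall u v : 'I_n, G u v = g u v.
Implicit Types (P : {set 'I_n * 'I_n}) (e : 'I_n * 'I_n).

Lemma planar_matchingP P :
  reflect ((forall e, e \in P -> 0 < g e.1 e.2) /\
           {in P &, forall e e', e != e' -> noncrossing e e'})
          (planar_matching G P).
Proof.
apply: (iffP andP) => -[P1 P2]; split.
- by move=> e eP; rewrite -Gg; apply: (forall_inP P1).
- by move=> e e' eP eP'; move/forall_inP/(_ e eP)/forall_inP/(_ e' eP')/implyP: P2.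
- by apply/forall_inP => e eP; rewrite Gg; apply: P1.
- by apply/forall_inP => e eP; apply/forall_inP => e' eP'; apply/implyP; apply: P2.
Qed.

Lemma planar_matching_subset P P' :
  P' \subset P -> planar_matching G P -> planar_matching G P'.
Proof.
move=> /subsetP sP /planar_matchingP [P1 P2]; apply/planar_matchingP.
by split=> [e /sP /P1 //|e e' /sP eP /sP eP']; apply: P2.
Qed.

Lemma card_planar_matching i j P : planar_matching G P ->
  (forall e, e \in P -> e.1 < i /\ e.2 < j) -> #|P| <= chain_len g i j.
Proof.
elim: i j P => [|i IHi] j P pP.
  move=> Pij; suff -> : P = set0 by rewrite cards0.
  by apply/setP => e; rewrite inE; apply/negP => /Pij [].
elim: j P pP => [|j IHj] P pP Pij.
  suff -> : P = set0 by rewrite cards0.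
  by apply/setP => e; rewrite inE; apply/negP => /Pij [].
have [P1 P2] := planar_matchingP P pP.
have [/existsP [e /andP [eP /eqP ei]]|/existsPn noi] :=
  boolP [exists e, (e \in P) && (e.1 == i :> nat)]; last first.
  apply: leq_trans (leq_chain_len g (leqnSn i) (leqnn _)); apply: IHi => // e eP.
  by have [? ?] := Pij e eP; move: (noi e); rewrite eP /=; lia.
have [/existsP [e' /andP [eP' /eqP ej]]|/existsPn noj] :=
  boolP [exists e, (e \in P) && (e.2 == j :> nat)]; last first.
  apply: leq_trans (leq_chain_len g (leqnn _) (leqnSn j)); apply: IHj => // e' eP'.
  by have [? ?] := Pij e' eP'; move: (noj e'); rewrite eP' /=; lia.
have ee' : e = e'.
  apply/eqP/negPn/negP => /(P2 _ _ eP eP'); rewrite /noncrossing.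
  case: (Pij e eP) (Pij e' eP') => _; rewrite !ltnS ei ej => h [h' _].
  by rewrite (ltnNge i) h' (ltnNge j) h /= !andbF.
subst e'; rewrite chain_lenS -ei -ej P1 // ei ej leq_max; apply/orP; right.
rewrite (cardsD1 e) eP ltnS; apply: IHi.
  by apply: planar_matching_subset pP; apply: subsetDl.
move=> f /setD1P [ne fP]; have := P2 _ _ fP eP ne; rewrite /noncrossing.
by have := Pij f fP; rewrite ei ej; lia.
Qed.

(** The recursion is followed backwards: either a smaller rectangle attains the maximum, or the
    corner edge is added to a matching strictly before it. *)
Lemma planar_matching_exists i j : i <= n -> j <= n ->
  exists P, [/\ planar_matching G P, forall e, e \in P -> e.1 < i /\ e.2 < j &
                #|P| = chain_len g i j].
Proof.
have empty i' j' : chain_len g i' j' = 0 ->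
    exists P, [/\ planar_matching G P, forall e, e \in P -> e.1 < i' /\ e.2 < j' &
                  #|P| = chain_len g i' j'].
  move=> ->; exists set0; split; rewrite ?cards0 //; last by move=> e; rewrite inE.
  by apply/planar_matchingP; split=> [e|e e']; rewrite inE.
elim: i j => [|i IHi] j lt_in; first by move=> _; apply: empty.
elim: j => [|j IHj] lt_jn; first by apply: empty; rewrite chain_len0r.
have grow i' j' : i' <= i.+1 -> j' <= j.+1 ->
    (exists P, [/\ planar_matching G P, forall e, e \in P -> e.1 < i' /\ e.2 < j' &
                  #|P| = chain_len g i' j']) -> chain_len g i' j' = chain_len g i.+1 j.+1 ->
    exists P, [/\ planar_matching G P, forall e, e \in P -> e.1 < i.+1 /\ e.2 < j.+1 &
                  #|P| = chain_len g i.+1 j.+1].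
  move=> ii jj [P [pP Pij cP]] <-; exists P; split=> // e eP.
  by have := Pij e eP; lia.
have := chain_lenS g i j; case: ifP => gij.
  set l1 := chain_len _ i.+1 j; set l2 := chain_len _ i j.+1; set l3 := chain_len _ i j => E.
  have [E1|[E2|E3]] : l1 = chain_len g i.+1 j.+1 \/ l2 = chain_len g i.+1 j.+1 \/
                      l3.+1 = chain_len g i.+1 j.+1 by lia.
  - by apply: grow E1 => //; apply: IHj; apply: ltnW.
  - by apply: grow E2 => //; apply: IHi => //; apply: ltnW.
  have [P [pP Pij cP]] := IHi j (ltnW lt_in) (ltnW lt_jn).
  have [P1 P2] := planar_matchingP P pP.
  pose e0 := (Ordinal lt_in, Ordinal lt_jn).
  have e0P : e0 \notin P by apply/negP => /Pij []; rewrite ltnn.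
  exists (e0 |: P); split; last by rewrite cardsU1 e0P cP.
    apply/planar_matchingP; split=> [e /setU1P [->//|]|e e' /setU1P [->|eP] /setU1P [->|eP']].
    + exact: P1.
    + by rewrite eqxx.
    + by move=> _; rewrite /noncrossing; have := Pij _ eP'; rewrite /=; lia.
    + by move=> _; rewrite /noncrossing; have := Pij _ eP; rewrite /=; lia.
    + exact: P2.
  by move=> e /setU1P [->|/Pij] /=; lia.
rewrite maxn0 => E.
have [E1|E2] : chain_len g i.+1 j = chain_len g i.+1 j.+1 \/
               chain_len g i j.+1 = chain_len g i.+1 j.+1 by lia.
- by apply: grow E1 => //; apply: IHj; apply: ltnW.
- by apply: grow E2 => //; apply: IHi => //; apply: ltnW.
Qed.

Lemma LmaxE : Lmax G = chain_len g n n.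
Proof.
apply/eqP; rewrite eqn_leq; apply/andP; split.
  by apply/bigmax_leqP => P pP; apply: card_planar_matching => // e _; rewrite !ltn_ord.
have [P [pP _ <-]] := planar_matching_exists (leqnn n) (leqnn n).
by rewrite /Lmax (bigD1 P pP) /= leq_maxl.
Qed.
End Matching.

(** * Lattice words and chains of partitions *)

Definition block r i (s : seq nat) := take r (drop (r * i) s).

Definition block_sorted r n (s : seq nat) := forall i, i < n -> sorted geq (block r i s).

(** The ballot, or Yamanouchi, condition: the content of every prefix is a partition. *)
Definition lattice_word (s : seq nat) :=
  forall p k, count_mem k.+1 (take p s) <= count_mem k (take p s).

Definition content r (s : seq nat) i k := count_mem k (take (r * i) s).

Lemma take_block r i s : take (r * i.+1) s = take (r * i) s ++ block r i s.
Proof. by rewrite mulnS addnC takeD. Qed.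

Lemma contentS r s i k : content r s i.+1 k = content r s i k + count_mem k (block r i s).
Proof. by rewrite /content take_block count_cat. Qed.

Lemma lattice_word_leq s p c1 c2 : lattice_word s -> c1 <= c2 ->
  count_mem c2 (take p s) <= count_mem c1 (take p s).
Proof.
move=> ls; elim: c2 => [|c2 IH]; first by rewrite leqn0 => /eqP ->.
by rewrite leq_eqVlt ltnS => /orP [/eqP -> //|/IH]; apply: leq_trans.
Qed.

Lemma sorted_geq_split t k : sorted geq t ->
  exists q, count_mem k (take q t) = 0 /\ count_mem k.+1 (take q t) = count_mem k.+1 t.
Proof.
elim: t => [|x t IH] st; first by exists 0.
case: (leqP x k) => xk.
  exists 0; split=> //; symmetry; apply/count_memPn/negP.
  have tr : transitive geq by move=> a b c ab bc; apply: leq_trans bc ab.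
  move: st; rewrite /= (path_sortedE tr) inE => /andP [/allP al _].
  by move=> /predU1P [|/al /=]; lia.
have [q [q1 q2]] := IH (path_sorted st).
by exists q.+1; rewrite /= q1 q2; split=> //; rewrite addn0; lia.
Qed.

(** The ballot condition is applied in the middle of the block, where every [k.+1] of it has been
    read but no [k]: this compares the later count of [k.+1] with the earlier count of [k]. *)
Lemma content_strip r n s i : block_sorted r n s -> lattice_word s -> i < n ->
  horizontal_strip (content r s i) (content r s i.+1).
Proof.
move=> bs ls lt_in k; rewrite !contentS leq_addr; split=> //.
have [q [q1 q2]] := sorted_geq_split k (bs i lt_in).
(* The split point [q] may exceed the block length, so it is cut off at [r]. *)
have := ls (r * i + minn q r) k.
rewrite takeD take_min -/(block r i s).
by rewrite !count_cat q1 q2 addn0.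
Qed.

(** Successive contents give the multiset of letters of each block, and a sorted block is determined
    by its multiset. *)
Lemma eq_block_sorted r n s1 s2 : size s1 = r * n -> size s2 = r * n ->
  block_sorted r n s1 -> block_sorted r n s2 ->
  (forall i, i <= n -> content r s1 i =1 content r s2 i) -> s1 = s2.
Proof.
move=> z1 z2 b1 b2 E.
rewrite -(take_size s1) -(take_size s2) z1 z2.
have: n <= n by [].
elim: {-2}n => [|i IH] lt_in; first by rewrite muln0 !take0.
rewrite !take_block IH ?(ltnW lt_in) //; congr (_ ++ _).
apply: (sorted_eq _ _ (b1 i lt_in) (b2 i lt_in)).
- by move=> a b c ab bc; apply: leq_trans bc ab.
- by move=> a b; rewrite andbC -eqn_leq => /eqP.
apply/allP => k _ /=; have := E i.+1 lt_in k.
by rewrite !contentS E ?(ltnW lt_in) // => /addnI ->.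
Qed.

Lemma size_sum_count d s : all (fun x => x < d) s -> size s = \sum_(k < d) count_mem (k : nat) s.
Proof.
elim: s => [|x s IH] /=; first by rewrite big1.
case/andP => xd /IH ->; rewrite big_split -add1n /=; congr (_ + _).
rewrite (bigD1 (Ordinal xd)) //= eqxx big1 // => k.
by rewrite -val_eqE /= eq_sym => /negPf ->.
Qed.

Fixpoint descending (mult : nat -> nat) j :=
  if j is j'.+1 then nseq (mult j') j' ++ descending mult j' else [::].

Lemma count_descending mult j k :
  count_mem k (descending mult j) = if k < j then mult k else 0.
Proof.
elim: j => [|j IH] //=; rewrite count_cat count_nseq IH /= ltnS eq_sym.
by case: ltngtP => [||->]; rewrite ?mul1n ?mul0n ?addn0.
Qed.

Lemma all_descending mult j : all (fun x => x < j) (descending mult j).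
Proof.
elim: j => [|j IH] //=; rewrite all_cat all_nseq ltnSn orbT /=.
by apply: sub_all IH => x; apply: ltnW.
Qed.

Lemma sorted_descending mult j : sorted geq (descending mult j).
Proof.
elim: j => [|j IH] //=; elim: (mult j) => [|m IHm] //=.
have tr : transitive geq by move=> a b c ab bc; apply: leq_trans bc ab.
rewrite (path_sortedE tr) IHm andbT all_cat all_nseq /= leqnn orbT /=.
by apply: sub_all (all_descending mult j) => x; apply: ltnW.
Qed.

(** The inverse of [content]: each strip of the chain is spelled out as one weakly decreasing
    block. *)
Fixpoint word_of d (alpha : nat -> nat -> nat) i :=
  if i is i'.+1 then
    word_of d alpha i' ++ descending (fun k => alpha i'.+1 k - alpha i' k) d
  else [::].

Section WordOf.
Variables (d n r : nat) (alpha : nat -> nat -> nat).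
Hypothesis alpha0 : forall k, alpha 0 k = 0.
Hypothesis alpha_bounded : forall i, i <= n -> bounded d (alpha i).
Hypothesis alpha_strip : forall i, i < n -> horizontal_strip (alpha i) (alpha i.+1).
Hypothesis alpha_sum : forall i, i <= n -> \sum_(k < d) alpha i k = r * i.
Let word := word_of d alpha.

Lemma count_word_of i k : i <= n -> count_mem k (word i) = alpha i k.
Proof.
elim: i => [|i IH] lt_in //=; rewrite count_cat IH ?(ltnW lt_in) // count_descending.
case: ltnP => kd; first by have [? _] := alpha_strip lt_in k; lia.
by rewrite !alpha_bounded // ltnW.
Qed.

Lemma all_word_of i : all (fun x => x < d) (word i).
Proof. by elim: i => [|i IH] //=; rewrite all_cat IH all_descending. Qed.

Lemma size_word_of i : i <= n -> size (word i) = r * i.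
Proof.
move=> le_in; rewrite (size_sum_count (all_word_of i)) -alpha_sum //.
by apply: eq_bigr => k _; rewrite count_word_of.
Qed.

Lemma take_word_of i j : i <= j -> j <= n -> take (r * i) (word j) = word i.
Proof.
move=> ij jn; elim: j ij jn => [|j IH].
  by rewrite leqn0 => /eqP -> _; rewrite take_oversize.
rewrite leq_eqVlt ltnS => /orP [/eqP -> jn|ij jn].
  by rewrite take_oversize // size_word_of.
rewrite /= takel_cat; first by apply: IH => //; apply: ltnW.
by rewrite size_word_of ?leq_mul2l ?ij ?orbT // ltnW.
Qed.

Lemma block_sorted_word_of : block_sorted r n (word n).
Proof.
move=> i lt_in; suff -> : block r i (word n) =
  descending (fun k => alpha i.+1 k - alpha i k) d by apply: sorted_descending.
have := take_block r i (word n); rewrite !take_word_of ?(ltnW lt_in) //=.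
by move/eqP; rewrite eqseq_cat // eqxx => /eqP.
Qed.

Lemma content_word_of i : i <= n -> content r (word n) i =1 alpha i.
Proof. by move=> le_in k; rewrite /content take_word_of // count_word_of. Qed.

(** For a prefix ending inside a block, the strip condition bounds all [k.+1] up to the end of that
    block by the [k] present before it. *)
Lemma lattice_word_of : lattice_word (word n).
Proof.
move=> p k; have: n <= n by []; elim: {-2}n => [|i IH] lt_in //.
rewrite /= take_cat; case: ltnP => _; first by apply: IH; apply: ltnW.
have [_] := alpha_strip lt_in k; rewrite -!count_word_of ?(ltnW lt_in) //=.
rewrite !count_cat; set t := descending _ _; set q := p - _.
have : count_mem k.+1 (take q t) <= count_mem k.+1 t.
  by rewrite -{2}(cat_take_drop q t) count_cat leq_addr.
move=> h1 h2; apply: leq_trans (leq_trans _ h2) (leq_addr _ _).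
by rewrite leq_add2l.
Qed.
End WordOf.

(** * Closed walks in the chamber as pairs of lattice words *)

Section Chamber.
Variables n r d : nat.
Implicit Type w : walk d (r * n).

Lemma count_wsteps (b0 : bool) (a b : seq 'I_d) k (c : 'I_d) :
  count (pred1 (b0, c)) (take k (wsteps a b)) =
  count_mem (c : nat) (if b0 then take k (map val a) else take (k - size a) (map val b)).
Proof.
have E (b1 : bool) (s : seq 'I_d) :
    count (pred1 (b0, c)) [seq (b1, x) | x <- s] =
    if b0 == b1 then count_mem (c : nat) (map val s) else 0.
  elim: s => [|x s IH] /=; first by case: ifP.
  by rewrite IH xpair_eqE (eq_sym b1) -val_eqE; case: ifP.
rewrite /wsteps take_cat size_map; case: ltnP => ka.
  rewrite -map_take E map_take; case: b0 {E} => //=.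
  by rewrite (eqP (ltnW ka)) take0.
rewrite count_cat -map_take !E map_take; case: b0 {E} => /=.
  by rewrite addn0 take_oversize // size_map.
by rewrite add0n.
Qed.

(* [in_Wtilde_chamberP] reads the negative half backwards, as a second walk starting at
   the origin; for [w] in [Wtilde], [word2 w] is thus the original word [b_1 ... b_m]. *)
Definition word1 w := map val w.1.
Definition word2 w := rev (map val w.2).

Lemma size_word1 w : size (word1 w) = r * n.
Proof. by rewrite size_map size_tuple. Qed.

Lemma size_word2 w : size (word2 w) = r * n.
Proof. by rewrite size_rev size_map size_tuple. Qed.

Lemma ends_at_originP w :
  reflect (forall c : 'I_d, count_mem (c : nat) (word1 w) = count_mem (c : nat) (word2 w))
          (ends_at_origin w).
Proof.
have E c : (wpos w.1 w.2 (r * n + r * n) c == 0)%R =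
    (count_mem (c : nat) (word1 w) == count_mem (c : nat) (word2 w)).
  rewrite /wpos GRing.subr_eq0 eqz_nat !count_wsteps /= !size_tuple addnK.
  by rewrite !take_oversize ?size_map ?size_tuple ?leq_addr // /word2 count_rev.
apply: (iffP forallP) => H c; first by apply/eqP; rewrite -E.
by rewrite E H.
Qed.

(** After the midpoint, the position equals the number of negative steps still to come, because the
    walk ends at the origin; these form a prefix of [word2 w]. *)
Lemma wposE w k (c : 'I_d) : ends_at_origin w -> k <= r * n + r * n ->
  wpos w.1 w.2 k c = if k <= r * n then count_mem (c : nat) (take k (word1 w))
                     else count_mem (c : nat) (take (r * n + r * n - k) (word2 w)).
Proof.
move=> /ends_at_originP /(_ c) E km; rewrite /wpos !count_wsteps size_tuple -/(word1 w).
case: leqP => mk.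
  by rewrite (eqP mk) take0 /= GRing.subr0.
rewrite take_oversize ?size_word1 ?(ltnW mk) // E /word2 take_rev !count_rev.
rewrite size_map size_tuple; have -> : r * n - (r * n + r * n - k) = k - r * n by lia.
rewrite -{1}(cat_take_drop (k - r * n) (map val w.2)) count_cat.
by rewrite PoszD GRing.addrC GRing.addKr.
Qed.

Lemma lattice_wordP (s : seq 'I_d) m : size s <= m ->
  (forall p (c1 c2 : 'I_d), p <= m -> c1 <= c2 ->
     count_mem (c2 : nat) (take p (map val s)) <= count_mem (c1 : nat) (take p (map val s))) ->
  lattice_word (map val s).
Proof.
move=> sm H p k; have [kd|dk] := ltnP k.+1 d; last first.
  suff -> : count_mem k.+1 (take p (map val s)) = 0 by [].
  apply/count_memPn; rewrite -map_take; apply/mapP => -[x _ e].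
  by have := ltn_ord x; rewrite -[X in X < d]/(val x) -e ltnNge dk.
have [pm|mp] := leqP p m.
  exact: (H p (Ordinal (ltnW kd)) (Ordinal kd)).
rewrite take_oversize ?size_map; last by apply: leq_trans sm (ltnW mp).
rewrite -[map val s](@take_oversize _ m) ?size_map //.
exact: (H m (Ordinal (ltnW kd)) (Ordinal kd)).
Qed.

Lemma in_chamberP w : ends_at_origin w ->
  in_chamber w <-> lattice_word (word1 w) /\ lattice_word (word2 w).
Proof.
move=> w0; have H : in_chamber w <-> forall k (c1 c2 : 'I_d), k <= r * n + r * n -> c1 <= c2 ->
   (wpos w.1 w.2 k c2 <= wpos w.1 w.2 k c1)%R.
  split=> [/forallP H k c1 c2 km|H].
    by move/(_ (Ordinal (km : k < (r * n + r * n).+1)))/forallP/(_ c1)/forallP/(_ c2)/implyP: H.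
  apply/forallP => k; apply/forallP => c1; apply/forallP => c2; apply/implyP.
  by apply: H; rewrite -ltnS.
rewrite H; split=> [L|[L1 L2] k c1 c2 km cc].
  split.
    apply: (@lattice_wordP _ (r * n)); rewrite ?size_tuple // => p c1 c2 pm cc.
    have pm' : p <= r * n + r * n by apply: leq_trans pm (leq_addr _ _).
    by have := L p c1 c2 pm' cc; rewrite !wposE // pm lez_nat.
  rewrite /word2 -map_rev; apply: (@lattice_wordP _ (r * n)); rewrite ?size_rev ?size_tuple //.
  move=> p c1 c2 pm cc; rewrite map_rev -/(word2 w).
  have := L (r * n + r * n - p) c1 c2 (leq_subr _ _) cc.
  rewrite !wposE ?leq_subr //; case: ifP => pm'; last first.
    by have -> : r * n + r * n - (r * n + r * n - p) = p by lia.
  (* Only the midpoint is covered by both formulas of [wposE]; there the two words have equal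
     counts. *)
  have -> : p = r * n by lia.
  rewrite lez_nat addnK !take_oversize ?size_word1 ?size_word2 //.
  by move/ends_at_originP: w0 => E; rewrite !E.
by rewrite !wposE //; case: ifP => _; rewrite lez_nat; apply: lattice_word_leq.
Qed.

Lemma block_sortedP s : 
  size s = r * n ->
  block_sorted r n s <->
  forall i t, i < n -> t.+1 < r -> nth 0 s (r * i + t.+1) <= nth 0 s (r * i + t).
Proof.
move=> zs; have zb i : i < n -> size (block r i s) = r.
  move=> lt_in; rewrite size_takel // size_drop zs -mulnBr.
  by rewrite -{1}(muln1 r) leq_mul2l subn_gt0 lt_in orbT.
have nb i t : t < r -> nth 0 (block r i s) t = nth 0 s (r * i + t).
  by move=> tr; rewrite nth_take // nth_drop.
split=> [bs i t lt_in tr|H i lt_in].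
  have /(sortedP 0) /(_ t) := bs i lt_in; rewrite zb // => /(_ tr).
  by rewrite !nb // ltnW.
apply/(sortedP 0) => t; rewrite zb // => tr.
by rewrite !nb ?(ltnW tr) //; apply: H.
Qed.

Lemma in_WtildeE w : w \in Wtilde n r d = ((w.1, rev_tuple w.2) \in Wprime n r d).
Proof.
have rK : involutive (fun w : walk d (r * n) => (w.1, rev_tuple w.2) : walk d (r * n)).
  by case=> a b; congr (_, _); apply: val_inj; rewrite /= revK.
apply/imsetP/idP => [[w' w'P ->]|wP]; first by rewrite (rK w').
by exists (w.1, rev_tuple w.2) => //; rewrite (rK w).
Qed.

Lemma in_Wtilde_chamberP w :
  w \in Wtilde_chamber n r d <->
  [/\ block_sorted r n (word1 w) /\ block_sorted r n (word2 w),
      lattice_word (word1 w) /\ lattice_word (word2 w) &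
      forall c : 'I_d, count_mem (c : nat) (word1 w) = count_mem (c : nat) (word2 w)].
Proof.
have E : map val (rev_tuple w.2) = word2 w by rewrite /= map_rev.
have O : ends_at_origin ((w.1, rev_tuple w.2) : walk d (r * n)) = ends_at_origin w.
  apply/ends_at_originP/ends_at_originP => H c; have := H c;
  by rewrite /word2 /word1 /= map_rev revK count_rev => ->.
rewrite inE in_WtildeE inE O.
split.
  move=> /andP [/andP [w0 bs] ch]; split; last exact/ends_at_originP.
    split; apply/block_sortedP; rewrite ?size_word1 ?size_word2 // => i t lt_in tr;
    move/forallP/(_ (Ordinal lt_in))/forallP/(_ (Ordinal (ltnW tr)))/implyP/(_ tr)/andP: bs => [];
    by rewrite E.
  exact/in_chamberP.
move=> [[b1 b2] L /ends_at_originP w0]; rewrite w0 /=.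
rewrite (in_chamberP w0).2 // andbT; apply/forallP => i; apply/forallP => t; apply/implyP => tr.
rewrite E; apply/andP; split.
  by have /(_ i t (ltn_ord i) tr) := (block_sortedP (size_word1 w)).1 b1.
by have /(_ i t (ltn_ord i) tr) := (block_sortedP (size_word2 w)).1 b2.
Qed.
End Chamber.

(** * Recovering a multigraph from its configuration *)

Section AssocConfig.
Variables n r : nat.
Implicit Types G : mgraph n.

Lemma leq_sum_after (F : 'I_n -> nat) (u : 'I_n) :
  \sum_(u' < n | u < u') F u' + F u <= \sum_(u' < n) F u'.
Proof.
rewrite [leqRHS](bigD1 u) //= addnC leq_add2l big_mkcond [leqRHS]big_mkcond /=.
apply: leq_sum => u' _; case: ifP => // uu'.
by rewrite (_ : u' != u) // -val_eqE /= neq_ltn uu' orbT.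
Qed.

Lemma assoc_config_interval G (u v : 'I_n) (i : 'I_r) : regular r G ->
  [exists y : 'I_r, ((u, i), (v, y)) \in assoc_config r G] =
  (iU G u v <= i < iU G u v + G u v).
Proof.
case=> _ Gv; apply/existsP/andP => [[y]|[i1 i2]].
  rewrite inE => /existsP [u' /existsP [v' /andP [_ /hasP [s]]]].
  rewrite mem_iota => si /and4P [/eqP /= uE /eqP /= iE /eqP /= vE _].
  by subst u' v'; lia.
have jr : jV G u v + G u v <= r by rewrite -(Gv v); apply: leq_sum_after.
(* The 0-based superscript [i] is [iU G u v + s - 1] for [s = (i - iU G u v).+1], which gives the
   partner's superscript. *)
have yr : jV G u v + G u v - (i - iU G u v).+1 < r by lia.
exists (Ordinal yr); rewrite inE; apply/existsP; exists u; apply/existsP; exists v.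
apply/andP; split; first by lia.
apply/hasP; exists (i - iU G u v).+1; first by rewrite mem_iota; lia.
by rewrite /= !eqxx /= andbT; apply/eqP; lia.
Qed.

(** The copies of [u] joined to copies of [v] form an interval of length [G u v]. Comparing the two
    intervals at their endpoints gives equal lengths, even when both are empty and start at
    different places. *)
Lemma assoc_config_inj G G' : regular r G -> regular r G' ->
  assoc_config r G = assoc_config r G' -> G = G'.
Proof.
move=> rG rG' E; apply/funext => u; apply/funext => v.
have I i : i < r -> (iU G u v <= i < iU G u v + G u v) = (iU G' u v <= i < iU G' u v + G' u v).
  move=> ir; have := assoc_config_interval u v (Ordinal ir) rG.
  by rewrite E assoc_config_interval //= => ->.
have le : iU G u v + G u v <= r by case: rG => Gu _; rewrite -(Gu u) leq_sum_after.
have le' : iU G' u v + G' u v <= r by case: rG' => Gu _; rewrite -(Gu u) leq_sum_after.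
move: (I (iU G u v)) (I (iU G' u v)) (I (iU G u v + G u v).-1) (I (iU G' u v + G' u v).-1).
by lia.
Qed.
End AssocConfig.

(** Uniqueness of [b] is asked only within [Q]: the relation used below sees the contents of blocks,
    and the order of letters within a block comes from membership in [Q]. *)
Lemma bijective_of_rel (A B : Type) (P : A -> Prop) (Q : B -> Prop) (R : A -> B -> Prop) :
  (forall a, P a -> exists2 b, Q b & R a b) ->
  (forall b, Q b -> exists2 a, P a & R a b) ->
  (forall a b b', Q b -> Q b' -> R a b -> R a b' -> b = b') ->
  (forall a a' b, R a b -> R a' b -> a = a') ->
  exists f : {a | P a} -> {b | Q b}, bijective f.
Proof.
move=> PQ QP fun1 fun2.
have sig_inj T (S : T -> Prop) (x y : {t | S t}) : sval x = sval y -> x = y.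
  by case: x y => x px [y py] /= xy; subst y; congr exist; apply: Prop_irrelevance.
have /choice [f fR] : forall x : {a | P a}, exists y : {b | Q b}, R (sval x) (sval y).
  by case=> a Pa; have [b Qb ab] := PQ a Pa; exists (exist _ b Qb).
have /choice [g gR] : forall y : {b | Q b}, exists x : {a | P a}, R (sval x) (sval y).
  by case=> b Qb; have [a Pa ab] := QP b Qb; exists (exist _ a Pa).
exists f; exists g => [x|y]; apply: sig_inj.
  exact: fun2 (gR (f x)) (fR x).
exact: fun1 (svalP _) (svalP _) (fR (g y)) (gR y).
Qed.

Lemma growth_ext d n g g' X : (forall i j, i < n -> j < n -> g i j = g' i j) ->
  growth d n g X -> growth d n g' X.
Proof.
by move=> E [PX HX VX RX]; split=> // i j lt_in lt_jn; rewrite -E //; apply: RX.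
Qed.

Lemma all_lt_tuple d m (s : seq nat) : 0 < d -> size s = m -> all (fun x => x < d) s ->
  exists t : m.-tuple 'I_d, map val t = s.
Proof.
move=> d0 <- sd; exists (map_tuple (insubd (Ordinal d0)) (in_tuple s)) => /=.
rewrite -map_comp -[RHS]map_id; apply/eq_in_map => x xs /=.
by rewrite val_insubd (allP sd).
Qed.

(** * The correspondence between configurations and walks *)

Section Correspondence.
Variables n r d : nat.
Hypotheses (n_gt0 : 0 < n) (d_gt0 : 0 < d).

(** The function [g] extends the multiplicities [G] to all naturals, as grids are indexed by [nat];
    its values outside the square are arbitrary. *)
Definition corresponds (C : config n r) (w : walk d (r * n)) :=
  exists (G : mgraph n) (g : nat -> nat -> nat) X, [/\ regular r G, C = assoc_config r G,
    forall u v : 'I_n, G u v = g u v, growth d n g X &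
    (forall i, i <= n -> X i n = content r (word1 w) i) /\
    (forall j, j <= n -> X n j = content r (word2 w) j)].

Lemma all_lt_word1 (w : walk d (r * n)) : all (fun x => x < d) (word1 w).
Proof. by apply/allP => x /mapP [y _ ->]; apply: ltn_ord. Qed.

Lemma all_lt_word2 (w : walk d (r * n)) : all (fun x => x < d) (word2 w).
Proof. by apply/allP => x; rewrite mem_rev => /mapP [y _ ->]; apply: ltn_ord. Qed.

Lemma content_bounded s i : all (fun x => x < d) s -> bounded d (content r s i).
Proof.
move=> sd k dk; apply/count_memPn/negP => /mem_take /(allP sd).
by rewrite ltnNge dk.
Qed.

Lemma content_sum s i : all (fun x => x < d) s -> size s = r * n -> i <= n ->
  \sum_(k < d) content r s i k = r * i.
Proof.
move=> sd zs le_in; rewrite -size_sum_count; last by apply/allP => x /mem_take /(allP sd).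
by rewrite size_takel // zs leq_mul2l le_in orbT.
Qed.

Lemma corresponds_walk C : Gbar n r d C ->
  exists2 w, w \in Wtilde_chamber n r d & corresponds C w.
Proof.
case=> G [[Gu Gv] [LG ->]].
pose x0 := Ordinal n_gt0.
pose g i j := G (insubd x0 i) (insubd x0 j).
have Gg (u v : 'I_n) : G u v = g u v by rewrite /g !valKd.
have gr i : i < n -> \sum_(j < n) g i j = r.
  by move=> lt_in; rewrite -(Gu (Ordinal lt_in)); apply: eq_bigr => j _; rewrite Gg.
have gc j : j < n -> \sum_(i < n) g i j = r.
  by move=> lt_jn; rewrite -(Gv (Ordinal lt_jn)); apply: eq_bigr => i _; rewrite Gg.
rewrite (LmaxE Gg) in LG.
have [X gX] := growth_exists d_gt0 LG; have [PX HX VX _] := gX.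
pose alpha i := X i n; pose beta j := X n j.
have a0 k : alpha 0 k = 0 by rewrite /alpha; have [_ ->] := PX 0 n (leq0n _) (leqnn _); auto.
have b0 k : beta 0 k = 0 by rewrite /beta; have [_ ->] := PX n 0 (leqnn _) (leq0n _); auto.
have ba i : i <= n -> bounded d (alpha i) by move=> lt_in; case: (PX i n).
have bb j : j <= n -> bounded d (beta j) by move=> lt_jn; case: (PX n j).
have ha i : i < n -> horizontal_strip (alpha i) (alpha i.+1).
  by move=> lt_in; apply: VX.
have hb j : j < n -> horizontal_strip (beta j) (beta j.+1).
  by move=> lt_jn; apply: HX.
have sa i : i <= n -> \sum_(k < d) alpha i k = r * i.
  move=> le_in; rewrite (growth_sum gX) //.
  rewrite (eq_bigr (fun=> r)) ?sum_nat_const ?card_ord 1?mulnC // => i' _.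
  by apply: gr; apply: leq_trans le_in.
have sb j : j <= n -> \sum_(k < d) beta j k = r * j.
  move=> le_jn; rewrite (growth_sum gX) // exchange_big /=.
  rewrite (eq_bigr (fun=> r)) ?sum_nat_const ?card_ord 1?mulnC // => j' _.
  by apply: gc; apply: leq_trans le_jn.
have [t1 e1] := all_lt_tuple d_gt0 (size_word_of a0 ba ha sa (leqnn n)) (all_word_of d alpha n).
have [t2 e2] := all_lt_tuple d_gt0 (size_word_of b0 bb hb sb (leqnn n)) (all_word_of d beta n).
(* The negative half is stored reversed, so that [word2 w] reads [t2]. *)
pose w : walk d (r * n) := (t1, rev_tuple t2).
have w1 : word1 w = word_of d alpha n by [].
have w2 : word2 w = word_of d beta n by rewrite /word2 /= map_rev revK.
exists w; last first.
  exists G, g, X; split=> //; rewrite w1 w2.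
  by split=> i lt_in; apply/funext => k; rewrite content_word_of.
apply/in_Wtilde_chamberP; rewrite w1 w2; split.
- by split; apply: block_sorted_word_of.
- by split; apply: lattice_word_of.
- by move=> c; rewrite (@count_word_of d n alpha) // (@count_word_of d n beta).
Qed.

Lemma corresponds_config w : w \in Wtilde_chamber n r d ->
  exists2 C, Gbar n r d C & corresponds C w.
Proof.
move=> /in_Wtilde_chamberP [[b1 b2] [l1 l2] E].
have [z1 z2] := (size_word1 w, size_word2 w).
have [d1 d2] := (all_lt_word1 w, all_lt_word2 w).
pose alpha := content r (word1 w); pose beta := content r (word2 w).
have [||||||| g [X [gX Xa Xb]]] := @growth_exists_bwd d n alpha beta.
- by move=> k; rewrite /alpha /content muln0 take0.
- by move=> k; rewrite /beta /content muln0 take0.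
- apply/funext => k; have [kd|dk] := ltnP k d; last by rewrite [LHS]content_bounded ?[RHS]content_bounded.
  by rewrite /alpha /beta /content !take_oversize ?z1 ?z2 // (E (Ordinal kd)).
- by move=> i _; apply: content_bounded.
- by move=> i _; apply: content_bounded.
- by move=> i; apply: content_strip.
- by move=> i; apply: content_strip.
pose G : mgraph n := fun u v => g u v.
have rG : regular r G.
  split=> u.
    (* The degree of [u] is the growth in size from [X u n] to [X u.+1 n], namely
       [r * u.+1 - r * u]. *)
    have := growth_sum gX (ltn_ord u) (leqnn n).
    rewrite Xa // content_sum // big_ord_recr -(growth_sum gX) ?(ltnW (ltn_ord u)) //=.
    by rewrite Xa ?content_sum ?(ltnW (ltn_ord u)) // mulnS addnC => /addnI.
  have := growth_sum gX (leqnn n) (ltn_ord u).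
  rewrite Xb // content_sum // exchange_big big_ord_recr exchange_big /=.
  rewrite -(growth_sum gX) ?(ltnW (ltn_ord u)) //=.
  by rewrite Xb ?content_sum ?(ltnW (ltn_ord u)) // mulnS addnC => /addnI.
exists (assoc_config r G); last by exists G, g, X.
by exists G; split=> //; split=> //; rewrite (@LmaxE _ G g) //; apply: growth_chain_len gX.
Qed.

(** The configuration gives the multigraph, forward uniqueness gives the outer boundary, and
    sortedness of the blocks gives the words. *)
Lemma corresponds_walk_uniq C w w' :
  w \in Wtilde_chamber n r d -> w' \in Wtilde_chamber n r d ->
  corresponds C w -> corresponds C w' -> w = w'.
Proof.
move=> /in_Wtilde_chamberP [[b1 b2] _ _] /in_Wtilde_chamberP [[b1' b2'] _ _].
move=> [G [g [X [rG -> Gg gX [X1 X2]]]]] [G' [g' [X' [rG' E Gg' gX' [X1' X2']]]]].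
have GG := assoc_config_inj rG rG' E; subst G'.
have {}gX' : growth d n g X'.
  apply: growth_ext gX' => i j lt_in lt_jn.
  by rewrite -(Gg (Ordinal lt_in) (Ordinal lt_jn)) Gg'.
have XX := growth_uniq_fwd gX gX'.
have e1 : word1 w = word1 w'.
  apply: eq_block_sorted b1 b1' _; rewrite ?size_word1 // => i lt_in k.
  by rewrite -X1 // -X1' // XX.
have e2 : word2 w = word2 w'.
  apply: eq_block_sorted b2 b2' _; rewrite ?size_word2 // => i lt_in k.
  by rewrite -X2 // -X2' // XX.
move: w w' e1 e2 {b1 b2 b1' b2' X1 X2 X1' X2'} => [a b] [a' b'] /= e1 e2; congr pair; apply: val_inj.
  exact: inj_map val_inj _ _ e1.
exact: inj_map val_inj _ _ (can_inj revK e2).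
Qed.

(** The walk fixes the outer boundary, from which backward uniqueness recovers every
    multiplicity. *)
Lemma corresponds_config_uniq C C' w : corresponds C w -> corresponds C' w -> C = C'.
Proof.
move=> [G [g [X [_ -> Gg gX [X1 X2]]]]] [G' [g' [X' [_ -> Gg' gX' [X1' X2']]]]].
congr assoc_config; apply/funext => u; apply/funext => v; rewrite Gg Gg'.
apply: growth_uniq_bwd gX gX' _ _ _ _ (ltn_ord u) (ltn_ord v) => i lt_in.
  by rewrite X1 // X1'.
by rewrite X2 // X2'.
Qed.
End Correspondence.

Theorem theorem6 (n r d : nat) :
  0 < n -> 0 < r -> 0 < d ->
  exists f : {C : config n r | Gbar n r d C} ->
             {w : walk d (r * n) | w \in Wtilde_chamber n r d},
    bijective f.
Proof.
move=> n_gt0 _ d_gt0; apply: (@bijective_of_rel _ _ _ _ (@corresponds n r d)).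
- by move=> C; apply: corresponds_walk.
- by move=> w; apply: corresponds_config.
- by move=> C w w'; apply: corresponds_walk_uniq.
- by move=> C C' w; apply: corresponds_config_uniq.
Qed.
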